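(* Let $N\ge2$, $m\ge1$, $L=(N-1)m-1$, let $\Lambda=(\Lambda_1,\dots,\Lambda_N)$ be an ordered partition of $\{1,\dots,Nm\}$ with $|\Lambda_i|=m$ for all $i$, let $\{p_1,\dots,p_L\}\subset\{1,\dots,Nm\}$ be any subset with $L$ elements, and let $\gamma_1,\dots,\gamma_L$ be cycles on the curve $C:s^N=\prod_{j=1}^{Nm}(z-\lambda_j)$. The function $$f(\lambda_1,\dots,\lambda_{Nm})_\Lambda=\frac{\Delta^{\frac{N-1}{N^2}}}{\prod_{i<j}(\Lambda_i\Lambda_j)}\;\frac{\det\big(\int_{\gamma_i}\mu^\Lambda_{p_j}\big)_{1\le i,j\le L}}{\Delta(p_1,\dots,p_L)}$$ is also written as $$f(\lambda_1,\dots,\lambda_{Nm})_\Lambda=\frac{\Delta^{\frac{N-1}{N^2}}}{\prod_{i<j}(\Lambda_i\Lambda_j)}\det\Big(\int_{\gamma_i}\zeta^\Lambda_j\Big)_{1\le i,j\le L}.$$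
   Context: $\lambda_1,\dots,\lambda_{Nm}$ are pairwise distinct complex numbers and $C$ is the compact Riemann surface defined by $s^N=f(z)=\prod_{j=1}^{Nm}(z-\lambda_j)$. Notation: $\Delta=\prod_{i<j}(\lambda_i-\lambda_j)$ (a branch of $\Delta^{(N-1)/N^2}$ is fixed), $\Delta(p_1,\dots,p_L)=\det(\lambda_{p_j}^{L-i})_{1\le i,j\le L}$, $(\Lambda_i\Lambda_j)=\prod_{r\in\Lambda_i,\,s\in\Lambda_j}(\lambda_r-\lambda_s)$, and the product $\prod_{i<j}(\Lambda_i\Lambda_j)$ is over $1\le i<j\le N$. For $p\in\Lambda_r$, $$g^{(\Lambda_r)}(z)=\prod_{j\notin\Lambda_r}(z-\lambda_j),\quad g_{\Lambda_r}(z)=\prod_{j\in\Lambda_r}(z-\lambda_j),\quad g_{\Lambda_r}^{(p)}(z)=\prod_{j\in\Lambda_r,\,j\ne p}(z-\lambda_j),$$ $$\mu_p^\Lambda=\frac{g^{(\Lambda_r)}(\lambda_p)\,g^{(p)}_{\Lambda_r}(z)}{(z-\lambda_p)\,s}\,dz .$$ For $1\le j\le L$, $$\zeta_j^\Lambda=\frac{dz}{s}\sum_{k=1}^N g_{\Lambda_k}(z)\Big[\frac{d}{dz}\frac{g^{(\Lambda_k)}(z)}{z^{L-j+1}}\Big]_0,$$ where $[\ \cdot\ ]_0$ denotes the polynomial part of a Laurent polynomial in $z$. *)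

(* Defs.v *)
From HB Require Import structures.
From mathcomp Require Import all_boot all_order all_algebra.
From mathcomp Require Import complex.
From mathcomp Require Import all_classical all_reals all_analysis.

Set Implicit Arguments.
Unset Strict Implicit.
Unset Printing Implicit Defensive.

Import Order.TTheory GRing.Theory Num.Theory.
Import numFieldNormedType.Exports.

Local Open Scope ring_scope.
Local Open Scope complex_scope.

(* The branch points are indexed by 'I_n with n = N m, so indices start at 0
   where the mathematics starts at 1. *)

Section Polynomials.
Variables (R : realType) (n : nat) (lam : 'I_n -> R[i]).

Definition curve_poly : {poly R[i]} := \prod_(j < n) ('X - (lam j)%:P).

(* g^(A)(z), g_A(z) and g_A^(p)(z) *)
Definition g_out (A : {set 'I_n}) : {poly R[i]} :=
  \prod_(j | j \notin A) ('X - (lam j)%:P).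
Definition g_in (A : {set 'I_n}) : {poly R[i]} :=
  \prod_(j in A) ('X - (lam j)%:P).
Definition g_in_but (A : {set 'I_n}) (p : 'I_n) : {poly R[i]} :=
  \prod_(j in A | j != p) ('X - (lam j)%:P).

Definition discr_root : R[i] :=
  \prod_(i < n) \prod_(j < n | (i < j)%N) (lam i - lam j).

Definition cross_prod (A B : {set 'I_n}) : R[i] :=
  \prod_(r in A) \prod_(s in B) (lam r - lam s).

(* Delta(p_1, ..., p_L); the row exponent L - i for 1 <= i <= L. *)
Definition vdm (L : nat) (p : 'I_L -> 'I_n) : R[i] :=
  \det (\matrix_(i < L, j < L) lam (p j) ^+ (L - i.+1)).

End Polynomials.

Section Partition.
Variables (N m : nat) (Lam : 'I_N -> {set 'I_(N * m)}).

Definition ordered_partition : Prop :=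
  [/\ forall i j, i != j -> [disjoint Lam i & Lam j],
      \bigcup_(i < N) Lam i = [set: 'I_(N * m)]%SET
    & forall i, #|Lam i| = m].

(* The block Lam_r containing p. *)
Definition block (p : 'I_(N * m)) : {set 'I_(N * m)} :=
  if [pick r | p \in Lam r] is Some r then Lam r else finset.set0.

End Partition.

Section Laurent.
Variable R : realType.

(* (g, k) stands for the Laurent polynomial g(z) / z^k. *)
Definition laurent := ({poly R[i]} * nat)%type.

(* d/dz (g / z^k) = (z g' - k g) / z^(k+1) *)
Definition laurent_deriv (h : laurent) : laurent :=
  (deriv h.1 * 'X - h.1 *+ h.2, h.2.+1).

Definition laurent_polypart (h : laurent) : {poly R[i]} := drop_poly h.2 h.1.

End Laurent.

Local Open Scope classical_set_scope.

Section Curve.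
Variables (R : realType) (N n : nat) (lam : 'I_n -> R[i]).

(* C minus its N points over z = oo: for pairwise distinct lam_j this affine
   curve is a closed complex submanifold of C^2, so that a path in it is C^1
   iff its two coordinates are. Differentials with poles over z = oo are only
   integrated along cycles lying in this part of C; every homology class of C
   contains such cycles. *)
Definition on_curve (P : R[i] * R[i]) : Prop :=
  P.2 ^+ N = (curve_poly lam).[P.1].

(* C^1 on the closed interval [0, 1]. *)
Definition C1_real (u : R -> R) : Prop :=
  [/\ {within `[0, 1], continuous u},
      {in `]0, 1[, forall t, derivable u t 1}
    & exists2 v : R -> R, {within `[0, 1], continuous v}
                        & {in `]0, 1[, forall t, derive1 u t = v t}].

Definition C1_complex (u : R -> R[i]) : Prop :=
  C1_real (fun t => complex.Re (u t)) /\ C1_real (fun t => complex.Im (u t)).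

Record curve_path := CurvePath {
  path_z : R -> R[i];
  path_s : R -> R[i];
  path_z_C1 : C1_complex path_z;
  path_s_C1 : C1_complex path_s;
  path_on_curve : {in `[0, 1], forall t, on_curve (path_z t, path_s t)} }.

Definition path_pt (c : curve_path) (t : R) : R[i] * R[i] :=
  (path_z c t, path_s c t).

(* 1-chains with integer coefficients. *)
Record curve_chain := CurveChain {
  chain_size : nat;
  chain_coef : 'I_chain_size -> int;
  chain_path : 'I_chain_size -> curve_path }.

(* The coefficient of the point P in the boundary 0-chain. *)
Definition boundary (c : curve_chain) (P : R[i] * R[i]) : int :=
  \sum_(k < chain_size c) chain_coef k *
    ((path_pt (chain_path k) 1 == P)%:R - (path_pt (chain_path k) 0 == P)%:R).

Record curve_cycle := CurveCycle {
  cycle_chain :> curve_chain;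
  cycle_closed : forall P, boundary cycle_chain P = 0 }.

(* The support of c misses the ramification point (lam q, 0). *)
Definition avoids (c : curve_chain) (q : 'I_n) : Prop :=
  forall k : 'I_(chain_size c),
    {in `[0, 1], forall t, path_z (chain_path k) t != lam q}.

(* A meromorphic differential, as a function of a point (z, s) of the curve
   and a tangent vector (dz, ds) there; its values at poles are meaningless. *)
Definition diff_form := R[i] * R[i] -> R[i] * R[i] -> R[i].

(* The differential dz / s.  Since N s^(N-1) ds = f'(z) dz on the curve, it
   equals N s^(N-2) ds / f'(z) near the ramification points, where s = 0 and
   f'(z) != 0; in particular it is holomorphic there. *)
Definition dz_over_s : diff_form := fun P v =>
  if P.2 != 0 then v.1 / P.2
  else N%:R * P.2 ^+ (N - 2) * v.2 / (deriv (curve_poly lam)).[P.1].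

Definition velocity (u : R -> R[i]) (t : R) : R[i] :=
  derive1 (fun x => complex.Re (u x)) t +i* derive1 (fun x => complex.Im (u x)) t.

Definition complex_integral (F : R -> R[i]) : R[i] :=
  (\int[lebesgue_measure]_(t in `[0, 1]) complex.Re (F t)) +i*
  (\int[lebesgue_measure]_(t in `[0, 1]) complex.Im (F t)).

Definition path_integral (c : curve_path) (w : diff_form) : R[i] :=
  complex_integral (fun t =>
    w (path_pt c t) (velocity (path_z c) t, velocity (path_s c) t)).

Definition chain_integral (c : curve_chain) (w : diff_form) : R[i] :=
  \sum_(k < chain_size c) (chain_coef k)%:~R * path_integral (chain_path k) w.

End Curve.

Section Forms.
Variables (R : realType) (N m : nat).
Variables (lam : 'I_(N * m) -> R[i]) (Lam : 'I_N -> {set 'I_(N * m)}).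

(* mu_p^Lam; its only pole is the ramification point (lam p, 0). *)
Definition mu_form (p : 'I_(N * m)) : diff_form R := fun P v =>
  (g_out lam (block Lam p)).[lam p] * (g_in_but lam (block Lam p) p).[P.1]
    / (P.1 - lam p) * dz_over_s N lam P v.

Definition zeta_poly (L j : nat) : {poly R[i]} :=
  \sum_(k < N) g_in lam (Lam k) *
    laurent_polypart (laurent_deriv (g_out lam (Lam k), (L - j + 1)%N)).

(* zeta_j^Lam for 1 <= j <= L; its only poles are the points over z = oo. *)
Definition zeta_form (L j : nat) : diff_form R := fun P v =>
  (zeta_poly L j).[P.1] * dz_over_s N lam P v.

(* D is a value of Delta^((N-1)/N^2): a fraction in lowest terms, so that its
   N^2 branches are exactly the roots of D^(N^2) = Delta^(N-1). *)
Definition is_branch (D : R[i]) : Prop :=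
  D ^+ (N ^ 2) = discr_root lam ^+ (N - 1).

Definition prefactor (D : R[i]) : R[i] :=
  D / \prod_(i < N) \prod_(j < N | (i < j)%N) cross_prod lam (Lam i) (Lam j).

(* f(lam_1, ..., lam_Nm)_Lam *)
Definition f_Lam (D : R[i]) (L : nat) (p : 'I_L -> 'I_(N * m))
    (gamma : 'I_L -> curve_cycle N lam) : R[i] :=
  prefactor D *
  (\det (\matrix_(i < L, j < L) chain_integral (gamma i) (mu_form (p j)))
   / vdm lam p).

End Forms.

(* Main.v *)
Require Import Defs.
From mathcomp Require Import all_boot all_order all_algebra all_field perm.
From mathcomp Require Import complex.
From mathcomp Require Import all_classical all_reals all_analysis.
From mathcomp Require Import zify ring.

Set Implicit Arguments.
Unset Strict Implicit.
Unset Printing Implicit Defensive.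

Import Order.TTheory GRing.Theory Num.Theory.
Import numFieldNormedType.Exports.
Local Open Scope ring_scope.

(* With a = lam_p and p in Lam_r, the geometric series 1/(z - a) at infinity
   turns sum_j a^(L-j) zeta_j into
     dz/s sum_k g_k(z) d/dz ((h_k(z) - h_k(a)) / (z - a)),
   where g_k = g_(Lam_k) and h_k = g^(Lam_k). Since g_k h_k = f,
   sum_k g_k h_k' = (N-1) f' and h_k(a) = 0 for k != r, this equals
   mu_p + N d(s^(N-1) / (z - a)). The exact term integrates to 0 along cycles
   avoiding (a, 0), so the matrix of the periods of the mu_(p_j) is that of the
   zeta_j times the Vandermonde matrix of the lam_(p_j).
   The form dz/s is handled at the ramification points through f dz/s =
   s^(N-1) dz, f' dz/s = N s^(N-2) ds and a Bezout relation between f and f',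
   which make it polynomial in z, s, dz, ds. *)

(** * Calculus of complex-valued functions on [0, 1] *)

Section ComplexValuedFunctions.
Local Open Scope classical_set_scope.
Context {R : realType}.
Implicit Types (F G : R -> R[i]) (t : R) (a d e : R[i]).
Local Notation Re := complex.Re.
Local Notation Im := complex.Im.

Lemma ReM a d : Re (a * d) = Re a * Re d - Im a * Im d.
Proof. by case: a d => [? ?] [? ?]. Qed.

Lemma ImM a d : Im (a * d) = Re a * Im d + Im a * Re d.
Proof. by case: a d => [? ?] [? ?]. Qed.

Lemma ReD a d : Re (a + d) = Re a + Re d.
Proof. by case: a d => [? ?] [? ?]. Qed.

Lemma ImD a d : Im (a + d) = Im a + Im d.
Proof. by case: a d => [? ?] [? ?]. Qed.

Lemma ReN a : Re (- a) = - Re a.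
Proof. by case: a. Qed.

Lemma ImN a : Im (- a) = - Im a.
Proof. by case: a. Qed.

Lemma ReV a : Re a^-1 = Re a * (Re a * Re a + Im a * Im a)^-1.
Proof. by case: a => [? ?] /=; rewrite -!expr2. Qed.

Lemma ImV a : Im a^-1 = - (Im a * (Re a * Re a + Im a * Im a)^-1).
Proof. by case: a => [? ?] /=; rewrite -!expr2 ?mulNr. Qed.

Lemma sqr_Re_Im_neq0 a : a != 0 -> Re a * Re a + Im a * Im a != 0.
Proof.
apply: contra; rewrite -!expr2 paddr_eq0 ?sqr_ge0// !sqrf_eq0 => ha.
by rewrite eq_complex.
Qed.

(** Componentwise, like [velocity] and [complex_integral], so that real analysis applies to [Re] and
    [Im] separately. *)
Definition ccont F :=
  {within `[0, 1], continuous (fun t => Re (F t) : R)} /\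
  {within `[0, 1], continuous (fun t => Im (F t) : R)}.

(** A two-sided derivative, hence used along paths only at points of the open interval. *)
Definition cderiv F t d :=
  is_derive t 1 (fun x => Re (F x)) (Re d) /\
  is_derive t 1 (fun x => Im (F x)) (Im d).

Lemma ccont_cst a : ccont (fun=> a).
Proof. by split=> t; exact: cst_continuous. Qed.

Lemma ccontD F G : ccont F -> ccont G -> ccont (fun t => F t + G t).
Proof.
move=> [F1 F2] [G1 G2]; split.
- under [fun t => Re _]eq_fun do rewrite ReD.
  by move=> t; exact: (@cvgD _ R^o _ _ _ _ _ _ _ (F1 t) (G1 t)).
- under [fun t => Im _]eq_fun do rewrite ImD.
  by move=> t; exact: (@cvgD _ R^o _ _ _ _ _ _ _ (F2 t) (G2 t)).
Qed.

Lemma ccontM F G : ccont F -> ccont G -> ccont (fun t => F t * G t).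
Proof.
move=> [F1 F2] [G1 G2]; split.
- under [fun t => Re _]eq_fun do rewrite ReM.
  by move=> t; exact: (@cvgB _ R^o _ _ _ _ _ _ _
    (cvgM (F1 t) (G1 t)) (cvgM (F2 t) (G2 t))).
- under [fun t => Im _]eq_fun do rewrite ImM.
  by move=> t; exact: (@cvgD _ R^o _ _ _ _ _ _ _
    (cvgM (F1 t) (G2 t)) (cvgM (F2 t) (G1 t))).
Qed.

Lemma ccontX F n : ccont F -> ccont (fun t => F t ^+ n).
Proof.
move=> cF; elim: n => [|n IHn]; first exact: ccont_cst.
by under eq_fun do rewrite exprS; exact: ccontM.
Qed.

Lemma ccont_horner (q : {poly R[i]}) F : ccont F -> ccont (fun t => q.[F t]).
Proof.
move=> cF; elim/poly_ind: q => [|q c IHq].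
  by under eq_fun do rewrite horner0; exact: ccont_cst.
under eq_fun do rewrite hornerMXaddC.
by apply: ccontD (ccont_cst _); exact: ccontM.
Qed.

Lemma cderiv_cst a t : cderiv (fun=> a) t 0.
Proof. by split; exact: is_derive_cst. Qed.

Lemma cderivD F G t d e : cderiv F t d -> cderiv G t e ->
  cderiv (fun x => F x + G x) t (d + e).
Proof.
move=> [F1 F2] [G1 G2]; split.
- under [fun x => Re _]eq_fun do rewrite ReD.
  by rewrite ?ReD ?ImD; exact: is_deriveD.
- under [fun x => Im _]eq_fun do rewrite ImD.
  by rewrite ?ReD ?ImD; exact: is_deriveD.
Qed.

Lemma cderivM F G t d e : cderiv F t d -> cderiv G t e ->
  cderiv (fun x => F x * G x) t (d * G t + F t * e).
Proof.
move=> [F1 F2] [G1 G2]; split.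
- under [fun _ => Re _]eq_fun do rewrite ReM.
  apply: is_derive_eq.
  by rewrite /GRing.scale/= !(ReM, ImM, ReD, ImD)/=; ring.
- under [fun _ => Im _]eq_fun do rewrite ImM.
  apply: is_derive_eq.
  by rewrite /GRing.scale/= !(ReM, ImM, ReD, ImD)/=; ring.
Qed.

Lemma ccontV F : {in `[0, 1], forall t, F t != 0} -> ccont F ->
  ccont (fun t => (F t)^-1).
Proof.
move=> F0 [F1 F2].
have nV : {within `[0, 1],
    continuous (fun t => (Re (F t) * Re (F t) + Im (F t) * Im (F t))^-1)}.
  apply/subspace_continuousP => t t01.
  have {}F1 := (subspace_continuousP _ _).1 F1 t t01.
  have {}F2 := (subspace_continuousP _ _).1 F2 t t01.
  apply: cvgV; first exact: sqr_Re_Im_neq0 (F0 t (mem_set t01)).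
  exact: (@cvgD _ R^o _ _ _ _ _ _ _ (cvgM F1 F1) (cvgM F2 F2)).
split.
- under [fun _ => Re _]eq_fun do rewrite ReV.
  by move=> t; exact: (cvgM (F1 t) (nV t)).
- under [fun _ => Im _]eq_fun do rewrite ImV.
  by move=> t; exact: (@cvgN _ R^o _ _ _ _ _ (cvgM (F2 t) (nV t))).
Qed.

Lemma cderivX F n t d : cderiv F t d ->
  cderiv (fun x => F x ^+ n) t (n%:R * F t ^+ n.-1 * d).
Proof.
move=> dF; elim: n => [|n IHn].
  by rewrite mul0r mul0r; exact: cderiv_cst.
under eq_fun do rewrite exprS.
suff -> : n.+1%:R * F t ^+ n.+1.-1 * d =
    d * F t ^+ n + F t * (n%:R * F t ^+ n.-1 * d) by exact: cderivM.
rewrite -natr1 mulrDl mul1r mulrDl addrC (mulrC d) /=; congr (_ + _).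
by case: n {IHn} => [|n]; rewrite ?mul0r ?mulr0//= exprS; ring.
Qed.

Lemma cderiv_horner (q : {poly R[i]}) F t d : cderiv F t d ->
  cderiv (fun x => q.[F x]) t ((deriv q).[F t] * d).
Proof.
move=> dF; elim/poly_ind: q => [|q c IHq].
  under eq_fun do rewrite horner0.
  by rewrite deriv0 horner0 mul0r; exact: cderiv_cst.
under eq_fun do rewrite hornerMXaddC.
have -> : (deriv (q * 'X + c%:P)).[F t] * d =
    ((deriv q).[F t] * d * F t + q.[F t] * d) + 0.
  by rewrite derivD derivM derivX derivC !hornerE; ring.
by apply: cderivD (cderiv_cst _ _); exact: cderivM.
Qed.

Lemma cderivV F t d : F t != 0 -> cderiv F t d ->
  cderiv (fun x => (F x)^-1) t (- d * ((F t)^-1 * (F t)^-1)).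
Proof.
move=> /sqr_Re_Im_neq0 F0 [F1 F2].
have dn := is_deriveV (f := fun x => Re (F x) * Re (F x) + Im (F x) * Im (F x))
  F0 (is_deriveD (is_deriveM F1 F1) (is_deriveM F2 F2)).
split.
- under [fun _ => Re _]eq_fun do rewrite ReV.
  apply: is_derive_eq.
  rewrite /GRing.scale/= !(ReM, ImM, ReV, ImV, ReN, ImN)/=.
  by field.
- under [fun _ => Im _]eq_fun do rewrite ImV.
  apply: is_derive_eq.
  rewrite /GRing.scale/= !(ReM, ImM, ReV, ImV, ReN, ImN)/=.
  by field.
Qed.

Lemma cderiv_unique F t d e : cderiv F t d -> cderiv F t e -> d = e.
Proof.
have is_derive_inj (f : R -> R) x y :
  is_derive t 1 f x -> is_derive t 1 f y -> x = y by move=> [_ <-] [_ <-].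
move=> [F1 F2] [G1 G2]; apply/eqP; rewrite eq_complex.
by rewrite (is_derive_inj _ _ _ F1 G1) (is_derive_inj _ _ _ F2 G2) !eqxx.
Qed.

(** A point of the open interval has a neighbourhood inside [[0, 1]]. This serves to differentiate
    the curve equation, which holds along a path only on [[0, 1]]. *)
Lemma near_eq_cderiv F G t d : t \in `]0, 1[ ->
  {in `[0, 1], F =1 G} -> cderiv F t d -> cderiv G t d.
Proof.
move=> t01 FG [F1 F2].
have nFG : \forall x \near t, F x = G x.
  near=> x; apply/FG/mem_set/subset_itv_oo_cc.
  by near: x; apply: near_in_itvoo; exact: set_mem t01.
by split; [apply: near_eq_is_derive F1|apply: near_eq_is_derive F2];
  apply: filterS nFG => x ->.
Unshelve. all: by end_near. Qed.

(** * Integration over [0, 1] *)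

Local Notation mu := (@lebesgue_measure R).

(** The endpoints have measure zero. Velocities are controlled only on the open interval, so [u] is
    left arbitrary at 0 and 1. *)
Lemma Rintegral_eq_itvoo (u v : R -> R) : {within `[0, 1], continuous v} ->
  {in `]0, 1[, u =1 v} ->
  \int[mu]_(t in `[0, 1]) u t = \int[mu]_(t in `[0, 1]) v t.
Proof.
move=> cv uv.
have iv : mu.-integrable `]0, 1[ (EFin \o v).
  apply: (@integrableS _ _ _ mu `[0%R, 1%R]) => //.
    exact: subset_itv_oo_cc.
  by apply: continuous_compact_integrable => //; exact: segment_compact.
have mv := measurable_int mu iv.
rewrite /Rintegral (integral_itv_bndoo _ _ mv) integral_itv_bndoo; last first.
  by apply: eq_measurable_fun mv => t /uv /= ->.
by congr fine; apply: eq_integral => t /uv ->.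
Qed.

Lemma eq_complex_integral F G : ccont G -> {in `]0, 1[, F =1 G} ->
  complex_integral F = complex_integral G.
Proof.
move=> [G1 G2] FG; rewrite /complex_integral.
by congr (_ +i* _)%C; apply: Rintegral_eq_itvoo => // t /FG ->.
Qed.

Lemma ccont_integrable F : ccont F ->
  mu.-integrable `[0, 1] (EFin \o (fun t => Re (F t))) /\
  mu.-integrable `[0, 1] (EFin \o (fun t => Im (F t))).
Proof.
by move=> [F1 F2]; split; apply: continuous_compact_integrable => //;
  exact: segment_compact.
Qed.

Lemma complex_integralD F G : ccont F -> ccont G ->
  complex_integral (fun t => F t + G t) =
  complex_integral F + complex_integral G.
Proof.
move=> /ccont_integrable[F1 F2] /ccont_integrable[G1 G2].
rewrite /complex_integral; apply/eqP; rewrite eq_complex ReD ImD/=.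
apply/andP; split; apply/eqP.
- by under eq_Rintegral do rewrite ReD; rewrite RintegralD.
- by under eq_Rintegral do rewrite ImD; rewrite RintegralD.
Qed.

Lemma complex_integralZ a F : ccont F ->
  complex_integral (fun t => a * F t) = a * complex_integral F.
Proof.
move=> cF; have /ccont_integrable[F1 F2] := cF.
have iZ (c : R) (w : R -> R) : mu.-integrable `[0, 1] (EFin \o w) ->
    mu.-integrable `[0, 1] (EFin \o (fun t => c * w t)).
  by move=> iw; apply: (@integrableZl _ _ _ mu _ _ c (EFin \o w)).
rewrite /complex_integral; apply/eqP; rewrite eq_complex ReM ImM/=.
apply/andP; split; apply/eqP.
- under eq_Rintegral do rewrite ReM.
  rewrite RintegralB ?RintegralZl//; exact: iZ.
- under eq_Rintegral do rewrite ImM.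
  rewrite RintegralD ?RintegralZl//; exact: iZ.
Qed.

Lemma complex_integral_sum n (H : 'I_n -> R -> R[i]) :
  (forall i, ccont (H i)) ->
  ccont (fun t => \sum_i H i t) /\
  complex_integral (fun t => \sum_i H i t) = \sum_i complex_integral (H i).
Proof.
elim: n H => [|n IHn] H cH.
  under eq_fun do rewrite big_ord0.
  split; first exact: ccont_cst.
  rewrite big_ord0 /complex_integral.
  by rewrite !Rintegral_cst//= !mul0r.
under eq_fun do rewrite big_ord_recr/=.
have [cS eS] := IHn (fun i => H (widen_ord (leqnSn n) i)) (fun i => cH _).
by split; [exact: ccontD|rewrite complex_integralD// eS big_ord_recr].
Qed.

Lemma complex_FTC F G : ccont F -> ccont G ->
  {in `]0, 1[, forall t, cderiv F t (G t)} ->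
  complex_integral G = F 1 - F 0.
Proof.
have FTC (u v : R -> R) : {within `[0, 1], continuous u} ->
    {within `[0, 1], continuous v} ->
    {in `]0, 1[, forall t, is_derive t 1 u (v t)} ->
    \int[mu]_(t in `[0, 1]) v t = u 1 - u 0.
  move=> /(continuous_within_itvP _ ltr01)[_ u0 u1] cv uv.
  rewrite /Rintegral (continuous_FTC2 ltr01 cv (F := u))//.
  - by split=> // t /mem_set/uv [].
  - by move=> t /mem_set/uv duv; rewrite derive1E; case: duv.
move=> [F1 F2] [G1 G2] FG.
apply/eqP; rewrite eq_complex !(ReD, ImD, ReN, ImN)/=.
apply/andP; split; apply/eqP.
- by apply: (FTC (fun t => Re (F t)) (fun t => Re (G t)) F1 G1) => t /FG [].
- by apply: (FTC (fun t => Im (F t)) (fun t => Im (G t)) F2 G2) => t /FG [].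
Qed.
End ComplexValuedFunctions.

(** * Polynomial identities *)

(** The polar part of [h / z^k] has a derivative with negative powers only, so the polynomial part
    can be taken before differentiating. *)
Lemma laurent_polypart_deriv (R : realType) (h : {poly R[i]}) (k : nat) :
  laurent_polypart (laurent_deriv (h, k)) = (drop_poly k h)^`().
Proof.
apply/polyP => i; rewrite /laurent_polypart /laurent_deriv /=.
rewrite coef_deriv !coef_drop_poly coefB coefMX coefMn addnS/= coef_deriv.
rewrite -mulrnBr ?leqW ?leq_addl// addSn.
by congr (_ *+ _); rewrite -addSn addnK.
Qed.

(** As [drop_poly i.+1 h] is the polynomial part of [h / z^(i+1)], the sum is that of the expansion
    of [h / (z - a)] at infinity, that is, the quotient of [h] by [z - a]. *)
Lemma sum_drop_poly_horner (F : comNzRingType) (h : {poly F}) (a : F)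
    (n : nat) :
  (size h <= n)%N ->
  (\sum_(i < n) a ^+ i *: drop_poly i.+1 h) * ('X - a%:P) = h - h.[a]%:P.
Proof.
move=> hn.
have dropS i : drop_poly i h = (h`_i)%:P + drop_poly i.+1 h * 'X.
  apply/polyP => -[|k]; rewrite !coefE/= ?addr0// ?add0r.
  by rewrite addSnnS.
rewrite (horner_coef_wide a hn).
(* With the remainder [a^n drop_poly n h] kept, the identity holds for every n and goes by
   induction. *)
transitivity (drop_poly 0 h - a ^+ n *: drop_poly n h -
              (\sum_(i < n) h`_i * a ^+ i)%:P); last first.
  by rewrite drop_poly0l (drop_poly_eq0 hn) scaler0 subr0.
elim: n {hn} => [|n IHn].
  by rewrite !big_ord0 mul0r expr0 scale1r subrr subr0.
rewrite !big_ord_recr/= mulrDl IHn polyCD !polyCM polyC_exp.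
rewrite (dropS n) -!mul_polyC !polyC_exp !exprS; ring.
Qed.

(* The first factor is q' for q = (h - h(a)) / (X - a), which satisfies
   q' (X - a) + q = h'. *)
Lemma sum_laurent_polypart (R : realType) (h : {poly R[i]}) (a : R[i])
    (L : nat) :
  (size h <= L.+2)%N ->
  (\sum_(j < L) a ^+ (L - j.+1) *:
     laurent_polypart (laurent_deriv (h, (L - j.+1 + 1)%N))) * ('X - a%:P) ^+ 2
  = h^`() * ('X - a%:P) - (h - h.[a]%:P).
Proof.
move=> hL; set q := \sum_(i < L.+2) a ^+ i *: drop_poly i.+1 h.
have Eq : q * ('X - a%:P) = h - h.[a]%:P by exact: sum_drop_poly_horner.
have -> : \sum_(j < L) a ^+ (L - j.+1) *:
    laurent_polypart (laurent_deriv (h, (L - j.+1 + 1)%N)) = q^`().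
  (* Since [h] has degree at most L + 1, the term of index L is constant and that of index L + 1 is
     zero, so neither contributes to [q']. The others are matched by i = L - 1 - j. *)
  rewrite /q !big_ord_recr/= !derivD [drop_poly L.+2 h]drop_poly_eq0//.
  rewrite scaler0 deriv0 addr0 derivZ.
  have /size1_polyC -> : (size (drop_poly L.+1 h) <= 1)%N.
    by rewrite size_drop_poly leq_subLR addn1.
  rewrite derivC scaler0 addr0 raddf_sum [RHS](reindex_inj rev_ord_inj)/=.
  by apply: eq_bigr => j _; rewrite laurent_polypart_deriv derivZ addn1.
rewrite -Eq; have := congr1 deriv Eq.
rewrite derivM !derivB derivX !derivC !subr0 mulr1 => <-; ring.
Qed.

Lemma deriv_prod (F : comNzRingType) (I : finType) (G : I -> {poly F}) :
  (\prod_i G i)^`() = \sum_i (G i)^`() * \prod_(j | j != i) G j.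
Proof.
elim: (index_enum I) (index_enum_uniq I) => [_|i r IHr /andP[ir ur]].
  by rewrite !big_nil derivC.
rewrite !big_cons derivM {}IHr// eqxx; congr (_ * _ + _).
  by rewrite [RHS]big_seq_cond [LHS]big_seq; apply: eq_bigl => j;
    case: (boolP (j \in r)) => //= jr; case: eqVneq jr => // ->;
    rewrite (negPf ir).
rewrite mulr_sumr 2!big_seq; apply: eq_bigr => j jr.
have ij : i != j by apply: contraNneq ir => ->.
by rewrite big_cons ij mulrCA.
Qed.

(** * Factorisations of the curve polynomial along the blocks *)

Section Partition.
Context {R : realType}.
Variables (N m : nat) (lam : 'I_(N * m) -> R[i]).
Variable (Lam : 'I_N -> {set 'I_(N * m)}).
Hypothesis (hN : (2 <= N)%N) (hLam : ordered_partition Lam).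

Lemma g_in_out (A : {set 'I_(N * m)}) :
  g_in lam A * g_out lam A = curve_poly lam.
Proof.
by rewrite /curve_poly (bigID (mem A)).
Qed.

Lemma g_in_monic (A : {set 'I_(N * m)}) : g_in lam A \is monic.
Proof. exact: monic_prod_XsubC. Qed.

Lemma size_g_out k : size (g_out lam (Lam k)) = (N * m - m).+1.
Proof.
case: hLam => _ _ /(_ k) cardLam.
rewrite /g_out (eq_bigl [in ~: Lam k]) => [|j]; last by rewrite !inE.
by rewrite -big_enum size_prod_XsubC -cardE cardsCs finset.setCK card_ord
  cardLam.
Qed.

Lemma curve_poly_partition : curve_poly lam = \prod_k g_in lam (Lam k).
Proof.
case: hLam => dis cov _; rewrite -(partition_disjoint_bigcup _ _ dis) cov.
by apply: eq_bigl => j; rewrite inE.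
Qed.

Lemma g_out_partition k :
  g_out lam (Lam k) = \prod_(j | j != k) g_in lam (Lam j).
Proof.
apply: (mulfI (monic_neq0 (g_in_monic (Lam k)))).
by rewrite g_in_out curve_poly_partition (bigD1 k).
Qed.

Lemma block_mem p r : p \in Lam r -> block Lam p = Lam r.
Proof.
case: hLam => dis _ _ pr; rewrite /block.
case: pickP => [k /= pk|/(_ r)]; last by rewrite pr.
case: (eqVneq k r) => [->//|/dis].
by move=> /disjoint_setI0 /setP/(_ p); rewrite !inE pk pr.
Qed.

Lemma mem_partition p : exists r, p \in Lam r.
Proof.
case: hLam => _ cov _; have : p \in \bigcup_(i < N) Lam i by rewrite cov inE.
by move=> /bigcupP[r _ ?]; exists r.
Qed.

(** Summing [f' = g_k' h_k + g_k h_k'] over the N blocks gives [N f'], while by the Leibniz rule for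
    [f = prod g_k] the terms [g_k' h_k] alone add up to [f']. *)
Lemma sum_g_in_deriv_g_out :
  \sum_(k < N) g_in lam (Lam k) * (g_out lam (Lam k))^`() =
  (curve_poly lam)^`() *+ (N - 1).
Proof.
apply: (addrI (curve_poly lam)^`()).
rewrite -mulrS [X in X^`() + _]curve_poly_partition deriv_prod -big_split/=.
rewrite (eq_bigr (fun=> (curve_poly lam)^`())) => [|k _].
  by rewrite sumr_const card_ord; congr (_ *+ _); lia.
by rewrite -g_out_partition -(g_in_out (Lam k)) derivM.
Qed.
End Partition.

(** This is [sum_laurent_polypart] for each [h_k] at [a = lam p], multiplied by [g_k]; the product
    [g_k h_k = f] appears once for each of the N blocks. *)
Lemma sum_zeta_poly (R : realType) (N m L : nat) (lam : 'I_(N * m) -> R[i])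
    (Lam : 'I_N -> {set 'I_(N * m)}) (hN : (2 <= N)%N)
    (hLam : ordered_partition Lam) (hL : (N * m - m <= L.+1)%N) p r :
  p \in Lam r ->
  (\sum_(j < L) lam p ^+ (L - j.+1) *: zeta_poly lam Lam L j.+1)
    * ('X - (lam p)%:P) ^+ 2 =
  (curve_poly lam)^`() *+ (N - 1) * ('X - (lam p)%:P) - curve_poly lam *+ N
  + (g_out lam (Lam r)).[lam p] *: g_in lam (Lam r).
Proof.
move=> pr; set a := lam p.
have -> : \sum_(j < L) a ^+ (L - j.+1) *: zeta_poly lam Lam L j.+1 =
    \sum_k g_in lam (Lam k) * \sum_(j < L) a ^+ (L - j.+1) *:
      laurent_polypart (laurent_deriv (g_out lam (Lam k), (L - j.+1 + 1)%N)).
  under eq_bigr do rewrite /zeta_poly scaler_sumr.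
  rewrite exchange_big; apply: eq_bigr => k _ /=; rewrite mulr_sumr.
  by apply: eq_bigr => j _; rewrite scalerAr.
transitivity (\sum_k (g_in lam (Lam k) * (g_out lam (Lam k))^`() * ('X - a%:P)
    - curve_poly lam + (g_out lam (Lam k)).[a] *: g_in lam (Lam k))).
  rewrite mulr_suml; apply: eq_bigr => k _.
  rewrite -[LHS]mulrA sum_laurent_polypart; last first.
    by rewrite (size_g_out lam hLam) ltnS.
  by rewrite -(g_in_out lam (Lam k)) -mul_polyC; ring.
rewrite !big_split/= -mulr_suml sum_g_in_deriv_g_out//.
rewrite sumr_const card_ord mulNrn.
(* For k other than r, p lies outside [Lam k], so [a] is a root of [h_k] and only [h_r(a) g_r]
   survives. *)
congr (_ + _); rewrite (bigD1 r)//= big1 ?addr0// => k kr.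
have pk : p \notin Lam k.
  case: hLam => /(_ _ _ kr)/disjoint_setI0/setP/(_ p) + _ _.
  by rewrite !inE pr andbT => ->.
by rewrite /g_out (bigD1 p)//= hornerM !hornerE subrr mul0r scale0r.
Qed.

(** * The differential dz/s at all points of the curve *)

Section Differentials.
Context {R : realType} {N n : nat} (lam : 'I_n -> R[i]).
Hypotheses (hN : (2 <= N)%N) (hlam : injective lam).
Local Notation f := (curve_poly lam).

(** The roots [lam j] of [f] are distinct, so [f] and [f'] are coprime. *)
Lemma curve_poly_Bezout : exists UV : {poly R[i]} * {poly R[i]},
  UV.1 * f + UV.2 * f^`() = 1.
Proof.
have : separable_poly f.
  rewrite /curve_poly -(big_map lam xpredT (fun x => 'X - x%:P)).
  rewrite separable_prod_XsubC map_inj_uniq//; exact: index_enum_uniq.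
rewrite unlock => /Bezout_coprimepP[[u v]/=].
rewrite -size_poly_eq1 => /size_poly1P[c c0 e].
exists (c^-1 *: u, c^-1 *: v); rewrite /= -!scalerAl -scalerDr e.
by rewrite scale_polyC mulVf.
Qed.

(** The equation [s^N = f(z)] differentiated in the direction [v]. *)
Definition tangent (P v : R[i] * R[i]) : Prop :=
  N%:R * P.2 ^+ (N - 1) * v.2 = f^`().[P.1] * v.1.

(** Where s is nonzero, [f / s = s^(N-1)]; where s = 0, both sides vanish because [N >= 2]. *)
Lemma curve_poly_dz_over_s P v : on_curve N lam P ->
  f.[P.1] * dz_over_s N lam P v = P.2 ^+ (N - 1) * v.1.
Proof.
rewrite /on_curve /dz_over_s => <-; case: eqVneq => /= [->|s0].
  by rewrite !expr0n; case: N hN => [|[|k]]//= _; rewrite !mul0r.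
by case: N hN => [|k]//= _; rewrite subn1/= exprSr; field.
Qed.

(** Where s = 0, the definition of [dz_over_s] divides by [f'], which is nonzero by the Bezout
    relation; elsewhere this is the tangency relation divided by s. *)
Lemma deriv_curve_poly_dz_over_s P v : on_curve N lam P -> tangent P v ->
  f^`().[P.1] * dz_over_s N lam P v = N%:R * P.2 ^+ (N - 2) * v.2.
Proof.
rewrite /on_curve /tangent /dz_over_s => cP tP; case: eqVneq => /= [s0|s0].
  have d0 : f^`().[P.1] != 0.
    have [[U V] /(congr1 (horner^~ P.1))/=] := curve_poly_Bezout.
    rewrite !hornerE -cP s0 expr0n (gtn_eqF (ltnW hN)) mulr0 add0r.
    by apply: contra_eq_neq => ->; rewrite mulr0 eq_sym oner_neq0.
  by rewrite [LHS]mulrC divfK.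
rewrite mulrA -tP; case: N hN => [|[|k]]//= _.
by rewrite subn1 subn2/= exprSr; field.
Qed.

End Differentials.

(** * Pointwise comparison of mu_p with the zeta_j *)

Section Forms.
Context {R : realType} {N m L : nat} (lam : 'I_(N * m) -> R[i]).
Context (Lam : 'I_N -> {set 'I_(N * m)}).
Hypotheses (hN : (2 <= N)%N) (hlam : injective lam).
Hypotheses (hLam : ordered_partition Lam) (hL : (N * m - m <= L.+1)%N).
Implicit Type p : 'I_(N * m).

(** The bracket multiplied by N is the value on [v] of the differential of
    [s^(N-1) / (z - lam p)]. *)
Lemma mu_formE p P v : on_curve N lam P -> tangent (N := N) lam P v ->
  P.1 != lam p ->
  mu_form lam Lam p P v =
  \sum_(j < L) lam p ^+ (L - j.+1) * zeta_form lam Lam L j.+1 P v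
  - N%:R * ((N - 1)%:R * P.2 ^+ (N - 2) * v.2 / (P.1 - lam p)
            - P.2 ^+ (N - 1) * v.1 / (P.1 - lam p) ^+ 2).
Proof.
move=> cP tP; rewrite -subr_eq0 => zp.
have [r pr] := mem_partition hLam p.
rewrite /mu_form (block_mem hLam pr).
have gP : g_in lam (Lam r) = ('X - (lam p)%:P) * g_in_but lam (Lam r) p.
  by rewrite /g_in (bigD1 p).
have fW := curve_poly_dz_over_s hN v cP.
have f'W := deriv_curve_poly_dz_over_s hN hlam cP tP.
rewrite /zeta_form; under [in RHS]eq_bigr do rewrite mulrA.
rewrite -mulr_suml; move: fW f'W.
set W := dz_over_s _ _ _ _; set Z := \sum_(j < L) _.
set h := (g_out _ _).[_]; set g := (g_in_but _ _ _).[_] => fW f'W.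
(* This is [sum_zeta_poly] evaluated at z and divided by [(z - lam p)^2]. *)
have -> : Z = ((N - 1)%:R * (curve_poly lam)^`().[P.1] * (P.1 - lam p)
    - N%:R * (curve_poly lam).[P.1] + h * ((P.1 - lam p) * g))
    / (P.1 - lam p) ^+ 2.
  apply: canRL (mulfK _) _; first by rewrite expf_neq0.
  have := congr1 (horner^~ P.1) (sum_zeta_poly lam hN hLam hL pr).
  rewrite gP /= !(hornerM, hornerD, hornerN, hornerZ, horner_exp, hornerMn).
  rewrite hornerX hornerC horner_sum mulr_natl [N%:R * _]mulr_natl.
  by under eq_bigr do rewrite hornerZ.
(* Once isolated, [f' W] and [f W] become polynomials in s, dz, ds; these cancel the exact term and
   leave [mu_p]. *)
transitivity (((N - 1)%:R * ((curve_poly lam)^`().[P.1] * W) * (P.1 - lam p)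
   - N%:R * ((curve_poly lam).[P.1] * W)) / (P.1 - lam p) ^+ 2 +
   h * g / (P.1 - lam p) * W - N%:R *
  ((N - 1)%:R * P.2 ^+ (N - 2) * v.2 / (P.1 - lam p) -
   P.2 ^+ (N - 1) * v.1 / (P.1 - lam p) ^+ 2)); last by field.
by rewrite f'W fW; field.
Qed.
End Forms.

(** * Integration along cycles *)

Section PathIntegrals.
Local Open Scope classical_set_scope.
Context {R : realType}.

(** The velocity at 0 and 1 involves values of [u] outside [[0, 1]], so it is replaced by a function
    continuous on [[0, 1]] that equals it on the open interval. *)
Lemma C1_complex_velocity (u : R -> R[i]) : C1_complex u ->
  ccont u /\ exists2 v, ccont v & {in `]0, 1[, forall t,
    velocity u t = v t /\ cderiv u t (v t)}.
Proof.
move=> [[c1 d1 [v1 cv1 e1]] [c2 d2 [v2 cv2 e2]]]; split; first by split.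
exists (fun t => (v1 t +i* v2 t)%C); first by split.
move=> t t01; split; first by rewrite /velocity e1// e2.
split; split=> /=; [exact: d1| |exact: d2|].
- by rewrite -e1// derive1E.
- by rewrite -e2// derive1E.
Qed.

Context {N m L : nat} (lam : 'I_(N * m) -> R[i]).
Context (Lam : 'I_N -> {set 'I_(N * m)}).
Hypotheses (hN : (2 <= N)%N) (hlam : injective lam).
Hypotheses (hLam : ordered_partition Lam) (hL : (N * m - m <= L.+1)%N).
Implicit Types (p : 'I_(N * m)) (P : R[i] * R[i]).

(** N times its differential is the sum of the [lam p ^+ (L - j) * zeta_j] minus [mu_p]. *)
Definition mu_primitive p P : R[i] := P.2 ^+ (N - 1) / (P.1 - lam p).

(** This is [mu_formE] integrated along the path. As z avoids [lam p], the exact term contributes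
    only its end values. *)
Lemma path_integral_mu p (c : curve_path N lam) :
  {in `[0, 1], forall t, path_z c t != lam p} ->
  path_integral c (mu_form lam Lam p) =
  \sum_(j < L) lam p ^+ (L - j.+1) * path_integral c (zeta_form lam Lam L j.+1)
  - N%:R * (mu_primitive p (path_pt c 1) - mu_primitive p (path_pt c 0)).
Proof.
case: c => z s z1 s1 on_c /= zp.
have [cz [vz cvz vzE]] := C1_complex_velocity z1.
have [cs [vs cvs vsE]] := C1_complex_velocity s1.
rewrite /path_integral /path_pt /=.
pose V t := (vz t, vs t); pose P t := (z t, s t).
have sub (t : R) : t \in `]0, 1[ -> t \in `[0, 1].
  by move=> /set_mem t01; apply/mem_set/subset_itv_oo_cc.
(* Both sides are the derivative at t of the same function [s^N = f(z)]. *)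
have tan (t : R) : t \in `]0, 1[ -> tangent (N := N) lam (P t) (V t).
  move=> t01; rewrite /tangent subn1/=.
  have [_ dz] := vzE t t01; have [_ ds] := vsE t t01.
  apply: (cderiv_unique _ (cderiv_horner (curve_poly lam) dz)).
  apply: near_eq_cderiv (cderivX N ds) => //.
have [[U W]/= UW] := curve_poly_Bezout hlam.
(* By [U f + W f' = 1] this is [dz / s] written without division, hence continuous even where the
   path meets a ramification point. *)
pose dzs t := U.[z t] * (s t ^+ (N - 1) * vz t)
  + W.[z t] * (N%:R * s t ^+ (N - 2) * vs t).
have dzsE (t : R) : t \in `]0, 1[ -> dz_over_s N lam (P t) (V t) = dzs t.
  move=> t01; have cP : on_curve N lam (P t) by exact: on_c t (sub t t01).
  rewrite /dzs -(curve_poly_dz_over_s hN (V t) cP).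
  rewrite -(deriv_curve_poly_dz_over_s hN hlam cP (tan t t01)) !mulrA -mulrDl.
  have := congr1 (horner^~ (z t)) UW.
  by rewrite /= hornerD !hornerM hornerC => ->; rewrite mul1r.
have cdzs : ccont dzs.
  exact: (ccontD (ccontM (ccont_horner U cz) (ccontM (ccontX _ cs) cvz))
    (ccontM (ccont_horner W cz)
      (ccontM (ccontM (ccont_cst _) (ccontX _ cs)) cvs))).
pose zeta j t := (zeta_poly lam Lam L j).[z t] * dzs t.
have czeta j : ccont (zeta j) by apply: ccontM => //; exact: ccont_horner.
have zetaE j : complex_integral (fun t =>
    zeta_form lam Lam L j (z t, s t) (velocity z t, velocity s t)) =
    complex_integral (zeta j).
  apply: eq_complex_integral => // t t01; have [-> _] := vzE t t01.
  by have [-> _] := vsE t t01; rewrite /zeta -dzsE.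
have zp0 (t : R) : t \in `[0, 1] -> z t + - lam p != 0.
  by move=> /zp; rewrite subr_eq0.
(* [G] is [mu_primitive p] along the path and [dG] its derivative. *)
pose G t := s t ^+ (N - 1) * (z t - lam p)^-1.
pose dG t := (N - 1)%:R * s t ^+ (N - 2) * vs t * (z t - lam p)^-1
  + s t ^+ (N - 1) * (-1 * vz t * ((z t - lam p)^-1 * (z t - lam p)^-1)).
have cV : ccont (fun t => (z t - lam p)^-1).
  by apply: ccontV => //; apply: ccontD => //; exact: ccont_cst.
have cG : ccont G by apply: ccontM => //; exact: ccontX.
have cdG : ccont dG.
  exact: (ccontD (ccontM (ccontM (ccontM (ccont_cst _) (ccontX _ cs)) cvs) cV)
    (ccontM (ccontX _ cs) (ccontM (ccontM (ccont_cst _) cvz) (ccontM cV cV)))).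
have intG : complex_integral dG = G 1 - G 0.
  apply: complex_FTC => // t t01.
  have [_ dz] := vzE t t01; have [_ ds] := vsE t t01.
  have -> : dG t = (N - 1)%:R * s t ^+ (N - 1).-1 * vs t * (z t - lam p)^-1
    + s t ^+ (N - 1) * (- (vz t + 0) * ((z t - lam p)^-1 * (z t - lam p)^-1)).
    by rewrite /dG addr0 mulN1r -subn1 -subnDA.
  apply: cderivM; first exact: cderivX.
  apply: cderivV; first exact/zp0/sub.
  exact: cderivD dz (cderiv_cst _ _).
have cZ (j : 'I_L) : ccont (fun t => lam p ^+ (L - j.+1) * zeta j.+1 t).
  by apply: ccontM => //; exact: ccont_cst.
have [cS eS] := complex_integral_sum cZ.
have cNG : ccont (fun t => - N%:R * dG t).
  by apply: ccontM => //; exact: ccont_cst.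
(* The integrand agrees with a continuous function on the open interval, which suffices for the
   integrals. *)
rewrite (@eq_complex_integral _ _ (fun t =>
  \sum_(j < L) lam p ^+ (L - j.+1) * zeta j.+1 t + - N%:R * dG t)); last 2 first.
- exact: ccontD.
- move=> t t01; have [-> _] := vzE t t01; have [-> _] := vsE t t01.
  have cP := on_c t (sub t t01).
  rewrite (mu_formE hN hlam hLam hL cP (tan t t01)); last exact/zp/sub.
  rewrite mulNr; congr (_ - _ * _).
    by apply: eq_bigr => j _; rewrite /zeta /zeta_form -dzsE.
  by rewrite /dG /= mulN1r mulNr mulrN -invfM -expr2 mulrA.
rewrite complex_integralD// eS complex_integralZ// intG mulNr.
congr (_ - _); apply: eq_bigr => j _.
by rewrite complex_integralZ// zetaE.
Qed.

(** The sum pairs [G] with the boundary 0-chain: collecting terms by endpoint gives the sum of the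
    [boundary c P * G P]. *)
Lemma boundary_sum (c : curve_chain N lam) (G : R[i] * R[i] -> R[i]) :
  (forall P, boundary c P = 0) ->
  \sum_(k < chain_size c) (chain_coef k)%:~R *
    (G (path_pt (chain_path k) 1) - G (path_pt (chain_path k) 0)) = 0.
Proof.
move=> c0.
pose e b (k : 'I_(chain_size c)) := path_pt (chain_path k) b.
(* The finitely many endpoints, without repetition, so that each indicator below selects exactly one
   term. *)
pose S := undup (codom (e 0) ++ codom (e 1)).
have GE P : P \in S -> G P = \sum_(Q <- S) (P == Q)%:R * G Q.
  move=> PS; rewrite (bigD1_seq P)//= ?undup_uniq// eqxx mul1r big1 ?addr0//.
  by move=> Q; rewrite eq_sym => /negPf ->; rewrite mul0r.
have eS b k : (b == 0) || (b == 1) -> e b k \in S.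
  by rewrite mem_undup mem_cat => /orP[] /eqP ->; rewrite codom_f ?orbT.
transitivity (\sum_(Q <- S) (boundary c Q)%:~R * G Q); last first.
  by apply: big1 => Q _; rewrite c0 mul0r.
transitivity (\sum_(k < chain_size c) \sum_(Q <- S)
    (chain_coef k * ((e 1 k == Q)%:R - (e 0 k == Q)%:R))%:~R * G Q).
  apply: eq_bigr => k _; rewrite -/(e 1 k) -/(e 0 k).
  rewrite (GE (e 1 k)) ?(GE (e 0 k)) ?eS ?eqxx ?orbT//.
  rewrite -sumrB mulr_sumr; apply: eq_bigr => Q _.
  by rewrite -mulrBl mulrA rmorphM rmorphB !rmorph_nat.
rewrite exchange_big; apply: eq_bigr => Q _.
by rewrite -mulr_suml /boundary rmorph_sum.
Qed.

(** Summed over the paths, the end values of [mu_primitive p] pair with the boundary of the cycle,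
    which is zero. *)
Lemma cycle_integral_mu p (c : curve_cycle N lam) : avoids c p ->
  chain_integral c (mu_form lam Lam p) =
  \sum_(j < L)
    chain_integral c (zeta_form lam Lam L j.+1) * lam p ^+ (L - j.+1).
Proof.
move=> cp; rewrite /chain_integral.
under eq_bigr do rewrite (path_integral_mu (cp _)) mulrBr.
rewrite sumrB; under [X in _ - X]eq_bigr do rewrite mulrCA.
rewrite -mulr_sumr (boundary_sum (mu_primitive p) (@cycle_closed _ _ _ _ c)).
rewrite mulr0 subr0; under eq_bigr do rewrite mulr_sumr.
rewrite exchange_big; apply: eq_bigr => j _; rewrite mulr_suml.
by apply: eq_bigr => k _; rewrite mulrCA mulrC.
Qed.

Lemma vdm_neq0 (p : 'I_L -> 'I_(N * m)) : injective p -> vdm lam p != 0.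
Proof.
move=> hp; rewrite /vdm.
(* The exponents decrease down the rows, so this is the standard Vandermonde matrix with its rows
   reversed. *)
have -> : \matrix_(i, j) lam (p j) ^+ (L - i.+1) =
    row_perm (perm (@rev_ord_inj L)) (Vandermonde L (\row_j lam (p j))).
  by apply/matrixP => i j; rewrite !mxE permE.
rewrite row_permE det_mulmx det_perm mulf_neq0 ?signr_eq0// det_Vandermonde.
apply/prodf_neq0 => i _; apply/prodf_neq0 => j ij.
by rewrite !mxE subr_eq0 (inj_eq hlam) (inj_eq hp) gt_eqF.
Qed.
End PathIntegrals.

(** * Factorisation of the period matrix *)

Theorem theorem2 (R : realType) (N m L : nat)
    (hN : (2 <= N)%N) (hm : (1 <= m)%N) (hL : L = ((N - 1) * m - 1)%N)
    (lam : 'I_(N * m) -> R[i]) (hlam : injective lam)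
    (Lam : 'I_N -> {set 'I_(N * m)}) (hLam : ordered_partition Lam)
    (p : 'I_L -> 'I_(N * m)) (hp : injective p)
    (gamma : 'I_L -> curve_cycle N lam)
    (hgamma : forall i j, avoids (gamma i) (p j))
    (D : R[i]) (hD : is_branch lam D) :
  f_Lam Lam D p gamma =
  prefactor lam Lam D *
  \det (\matrix_(i < L, j < L) chain_integral (gamma i) (zeta_form lam Lam L j.+1)).
Proof.
rewrite /f_Lam; congr (_ * _).
have -> : \matrix_(i < L, j < L)
      chain_integral (gamma i) (mu_form lam Lam (p j)) =
    (\matrix_(i < L, j < L)
      chain_integral (gamma i) (zeta_form lam Lam L j.+1)) *m
    (\matrix_(i < L, j < L) lam (p j) ^+ (L - i.+1)).
  (* Each [h_k] has degree [(N-1) m], which is at most L + 1. *)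
  have hL' : (N * m - m <= L.+1)%N by rewrite hL mulnBl mul1n; lia.
  apply/matrixP => i j.
  rewrite !mxE (cycle_integral_mu hN hlam hLam hL' (hgamma i j)).
  by apply: eq_bigr => k _; rewrite !mxE.
by rewrite det_mulmx mulfK// vdm_neq0.
Qed.
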